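(* Let $d\ge 1$ and let $\mathcal{U}$ be a subcritical $d$-dimensional update family. Then $p_c(\mathbb{Z}^d,\mathcal{U}) > 0$.
   Context: A $d$-dimensional update family is a finite collection $\mathcal{U}=\{X_1,\dots,X_m\}$ of finite, non-empty subsets of $\mathbb{Z}^d\setminus\{\mathbf{0}\}$. Given $A\subset\mathbb{Z}^d$, set $A_0=A$ and, for $t\ge 1$, $A_t=A_{t-1}\cup\{x\in\mathbb{Z}^d : x+X\subset A_{t-1}\text{ for some }X\in\mathcal{U}\}$. The $\mathcal{U}$-closure of $A$ is $[A]_{\mathcal{U}}:=\bigcup_{t\ge 0}A_t$. Write $\mathbb{P}_p$ for the law of a $p$-random set $A\subset\mathbb{Z}^d$ (each site of $\mathbb{Z}^d$ is included in $A$ independently with probability $p$). The critical probability is $p_c(\mathbb{Z}^d,\mathcal{U}):=\inf\{p : \mathbb{P}_p([A]_{\mathcal{U}}=\mathbb{Z}^d)\ge 1/2\}$. Let $\mathbf{S}^{d-1}$ be the unit sphere in $\mathbb{R}^d$. For $u\in\mathbf{S}^{d-1}$ let $\mathbb{H}_u^d:=\{x\in\mathbb{Z}^d : \langle x,u\rangle<0\}$. The set of stable directions is $\mathcal{S}=\mathcal{S}(\mathcal{U}):=\{u\in\mathbf{S}^{d-1} : [\mathbb{H}_u^d]_{\mathcal{U}}=\mathbb{H}_u^d\}$. The family $\mathcal{U}$ is subcritical if $\operatorname{int}(H\cap\mathcal{S})\neq\emptyset$ for every hemisphere $H\subset\mathbf{S}^{d-1}$, where $\operatorname{int}$ denotes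 interior in the usual topology of $\mathbf{S}^{d-1}$. *)

(* Defs.v *)
From HB Require Import structures.
From mathcomp Require Import all_boot all_order all_algebra.
From mathcomp Require Import finmap.
From mathcomp Require Import all_classical all_reals all_analysis.
From mathcomp Require Import measurable_realfun lra.

Set Implicit Arguments.
Unset Strict Implicit.
Unset Printing Implicit Defensive.

Import Order.TTheory GRing.Theory Num.Theory.
Import numFieldNormedType.Exports.

Local Open Scope classical_set_scope.
Local Open Scope ring_scope.

Notation Zd d := 'rV[int]_d (only parsing).

Definition update_family (d : nat) (U : set (set (Zd d))) : Prop :=
  finite_set U /\
  forall X, U X -> [/\ finite_set X, X !=set0 & ~ X 0].

Fixpoint infected (d : nat) (U : set (set (Zd d))) (A : set (Zd d)) (t : nat) :
    set (Zd d) :=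
  if t is t'.+1 then
    infected U A t' `|`
    [set x | exists2 X, U X & [set x + y | y in X] `<=` infected U A t']
  else A.

Definition Uclosure (d : nat) (U : set (set (Zd d))) (A : set (Zd d)) :
    set (Zd d) :=
  \bigcup_t infected U A t.

Definition site_events (d : nat) : set (set (set (Zd d))) :=
  range (fun x : Zd d => [set A : set (Zd d) | A x]).

(* Subsets of Z^d with the product sigma-algebra. *)
Definition config (d : nat) := g_sigma_algebraType (@site_events d).

Definition mutually_independent (disp : measure_display)
    (T : measurableType disp) (R : realType) (P : probability T R)
    (I : choiceType) (E : I -> set T) : Prop :=
  forall S : {fset I},
    P (\bigcap_(i in [set` S]) E i) = (\prod_(i <- S) P (E i))%E.

Definition is_random_set_law (R : realType) (d : nat) (p : R)
    (P : probability (config d) R) : Prop :=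
  (forall x : Zd d, P [set A : config d | A x] = p%:E) /\
  mutually_independent P (fun x : Zd d => [set A : config d | A x]).

(* Existence of the law: for x uniform on ]0, 1], the map T = bernoulli_shift is
   affine from ]0, p] and from ]p, 1] onto ]0, 1], so the events
   "T^k x <= p", k : nat, are mutually independent, each of probability p. *)
Section affine.
Context (R : realType).
Let mu : {measure set (measurableTypeR R) -> \bar R} := lebesgue_measure.

Lemma lebesgue_affine_preimage (a c : R) (B : set (measurableTypeR R)) :
  0 < a -> measurable B ->
  mu ((fun x : R => a * x + c) @^-1` B) = ((a^-1)%:E * mu B)%E.
Proof.
move=> a0 mB; pose f : measurableTypeR R -> measurableTypeR R := fun x => a * x + c.
have mf : measurable_fun [set: measurableTypeR R] f.
  apply: measurable_funD => //; apply: measurable_funM => //.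
pose af := NngNum (ltW a0).
pose nu : {measure set (measurableTypeR R) -> \bar R} :=
  mscale af (pushforward mu f).
have H : mu B = nu mf B.
  apply: lebesgue_measure_unique => // _ [[u v] _ <-] /=.
  rewrite /mscale /= /pushforward.
  have -> : f @^-1` `]u, v] = `](u - c) / a, (v - c) / a]%classic.
    apply/seteqP; split=> x /=; rewrite !in_itv/= /f;
      by rewrite ltr_pdivrMr// ler_pdivlMr// ltrBlDr lerBrDr (mulrC x).
  rewrite /mu !lebesgue_measure_itv/= !lte_fin ltr_pM2r ?invr_gt0// ltrD2r.
  case: ifPn => uv; last by rewrite mule0.
  by rewrite -!EFinB -EFinM -mulrBl mulrCA divff ?gt_eqF// mulr1; congr EFin; lra.
rewrite H /mscale/= muleA -EFinM mulVf ?gt_eqF// mul1e.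
by [].
Qed.
End affine.

Section digits.
Context (R : realType) (p : R) (p01 : 0 <= p <= 1).
Let TR : measurableType _ := measurableTypeR R.
Let mu : {measure set TR -> \bar R} := lebesgue_measure.
Let I1 : set TR := `]0, 1]%classic.

Definition bernoulli_digit (x : TR) : bool := x <= p.
Definition bernoulli_shift (x : TR) : TR := if x <= p then x / p else (x - p) / (1 - p).

Let measurable_digit : measurable_fun setT bernoulli_digit.
Proof. exact: measurable_fun_ler. Qed.

Let measurable_shift : measurable_fun setT bernoulli_shift.
Proof.
apply: measurable_fun_ifT; first exact: measurable_fun_ler.
- by apply: measurable_funM.
- by apply: measurable_funM => //; apply: measurable_funB.
Qed.

Lemma measurable_digit_shift k : measurable_fun setT (bernoulli_digit \o iter k bernoulli_shift).
Proof.
apply: measurableT_comp => //; elim: k => [|k IH] /=; first exact: measurable_id.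
exact: (measurableT_comp measurable_shift IH).
Qed.

Let mI1 : measurable I1. Proof. exact: measurable_itv. Qed.
Let mdig (b : bool) : measurable [set x : TR | bernoulli_digit x = b].
Proof.
have := measurable_digit measurableT (Y := [set b]) (I : measurable [set b]).
by rewrite setTI.
Qed.
Let msh (B : set TR) : measurable B -> measurable (bernoulli_shift @^-1` B).
Proof. by move=> mB; rewrite -[X in measurable X]setTI; exact: measurable_shift. Qed.

Let lebesgue_shift1 (B : set TR) : measurable B ->
  mu (I1 `&` [set x | bernoulli_digit x = true] `&` bernoulli_shift @^-1` B) =
  (p%:E * mu (I1 `&` B))%E.
Proof.
move=> mB; have /andP[p0 p1] := p01.
have [pE|pN0] := eqVneq p 0.
  rewrite pE mul0e [X in mu X](_ : _ = set0) ?measure0//.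
  apply/seteqP; split=> x //= -[[]]; rewrite /I1/= in_itv/= /bernoulli_digit pE.
  by move=> /andP[x0 _] xp; move: (lt_le_trans x0 xp); rewrite ltxx.
have pp : 0 < p by rewrite lt_neqAle eq_sym pN0.
rewrite -[p in RHS]invrK -(@lebesgue_affine_preimage R p^-1 0) ?invr_gt0//;
  last exact: measurableI.
congr (mu _); apply/seteqP; split=> x /=; rewrite /I1/= !in_itv/= /bernoulli_digit /bernoulli_shift.
  move=> [[/andP[x0 x1] xp]]; rewrite xp addr0 (mulrC _ x) => Bx; split=> //.
  by rewrite divr_gt0//= ler_pdivrMr// mul1r.
rewrite addr0 (mulrC _ x) => -[/andP[]].
rewrite ler_pdivrMr// mul1r pmulr_lgt0 ?invr_gt0// => x0 xp Bx.
by rewrite xp x0 (le_trans xp p1).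
Qed.

Let lebesgue_shift0 (B : set TR) : measurable B ->
  mu (I1 `&` [set x | bernoulli_digit x = false] `&` bernoulli_shift @^-1` B) =
  ((1 - p)%:E * mu (I1 `&` B))%E.
Proof.
move=> mB; have /andP[p0 p1] := p01.
have [pE|pN1] := eqVneq p 1.
  rewrite pE subrr mul0e [X in mu X](_ : _ = set0) ?measure0//.
  apply/seteqP; split=> x //= -[[]]; rewrite /I1/= in_itv/= /bernoulli_digit pE.
  by move=> /andP[_ ->].
have pp : 0 < 1 - p by rewrite subr_gt0 lt_neqAle pN1.
rewrite -[1 - p in RHS]invrK
  -(@lebesgue_affine_preimage R (1 - p)^-1 (- p / (1 - p))) ?invr_gt0//;
  last exact: measurableI.
congr (mu _); apply/seteqP; split=> x /=; rewrite /I1/= !in_itv/= /bernoulli_digit /bernoulli_shift.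
  move=> [[/andP[x0 x1] xp]]; rewrite xp (mulrC _ x) -mulrDl => Bx; split=> //.
  have px : p < x by rewrite ltNge xp.
  apply/andP; split; first by rewrite divr_gt0// subr_gt0.
  by rewrite ler_pdivrMr// mul1r lerD2r.
rewrite (mulrC _ x) -mulrDl => -[/andP[]].
rewrite ler_pdivrMr// mul1r lerD2r pmulr_lgt0 ?invr_gt0// subr_gt0 => px x1 Bx.
have xp : (x <= p) = false by apply: negbTE; rewrite -ltNge.
by rewrite xp (le_lt_trans p0 px) x1.
Qed.

Let lebesgue_shift (B : set TR) : measurable B ->
  mu (I1 `&` bernoulli_shift @^-1` B) = mu (I1 `&` B).
Proof.
move=> mB; rewrite (_ : I1 `&` bernoulli_shift @^-1` B =
    (I1 `&` [set x | bernoulli_digit x = true] `&` bernoulli_shift @^-1` B) `|`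
    (I1 `&` [set x | bernoulli_digit x = false] `&` bernoulli_shift @^-1` B)); last first.
  apply/seteqP; split=> x /=; last by case=> -[[]].
  by move=> [Ix Bx]; case: (boolP (bernoulli_digit x)) => [d1|/negbTE d0]; [left|right].
rewrite measureU.
- transitivity (p%:E * mu (I1 `&` B) + (1 - p)%:E * mu (I1 `&` B))%E.
    by congr (_ + _)%E; [exact: lebesgue_shift1|exact: lebesgue_shift0].
  rewrite -ge0_muleDl ?lee_fin ?subr_ge0; try by case/andP: p01.
  by rewrite -EFinD subrKC mul1e.
- by apply: measurableI; [exact: measurableI|exact: msh].
- by apply: measurableI; [exact: measurableI|exact: msh].
- by apply/seteqP; split=> x //= [[[_ ->]] _ [[]]].
Qed.

Let cyl n (b : nat -> bool) : set TR :=
  [set x | forall i, (i < n)%N -> b i -> bernoulli_digit (iter i bernoulli_shift x) = true].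

Let measurable_cyl n b : measurable (cyl n b).
Proof.
rewrite (_ : cyl n b = \bigcap_(i in [set i | (i < n)%N && b i])
    ((bernoulli_digit \o iter i bernoulli_shift) @^-1` [set true])); last first.
  apply/seteqP; split=> x /= H i; first by case/andP; exact: H.
  by move=> ilt bi; apply: H; rewrite /= ilt.
apply: bigcap_measurableType => i _.
by rewrite -[X in measurable X]setTI; exact: measurable_digit_shift.
Qed.

Let lebesgue_cyl n b : mu (I1 `&` cyl n b) = (p ^+ count b (iota 0 n))%:E.
Proof.
elim: n b => [|n IH] b.
  rewrite (_ : cyl 0 b = setT); last by apply/seteqP; split.
  rewrite setIT; apply: (etrans (lebesgue_measure_itv _)).
  by rewrite /= lte_fin ltr01 oppr0 adde0.
pose b' i := b i.+1.
have -> : count b (iota 0 n.+1) = (b 0%N + count b' (iota 0 n))%N.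
  by rewrite /= (iotaDl 1 0 n) count_map.
have [b0|b0] := boolP (b 0%N).
  rewrite (_ : _ `&` _ = I1 `&` [set x | bernoulli_digit x = true] `&` bernoulli_shift @^-1` cyl n b').
    transitivity (p%:E * mu (I1 `&` cyl n b'))%E.
      by apply: lebesgue_shift1; exact: measurable_cyl.
    by rewrite IH -EFinM -exprS.
  apply/seteqP; split=> x /=.
    move=> [Ix H]; split; first by split=> //; exact: (H 0%N).
    by move=> i ilt bi; rewrite -iterSr; exact: H.
  move=> [[Ix d0] H]; split=> // -[//|i] ilt bi.
  by rewrite iterSr; exact: H.
rewrite (_ : _ `&` _ = I1 `&` bernoulli_shift @^-1` cyl n b').
  transitivity (mu (I1 `&` cyl n b')); last exact: IH.
  by apply: lebesgue_shift; exact: measurable_cyl.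
apply/seteqP; split=> x /= [Ix H]; split=> //.
  by move=> i ilt bi; rewrite -iterSr; exact: H.
move=> [|i] ilt bi; first by rewrite bi in b0.
by rewrite iterSr; exact: H.
Qed.

Variable d : nat.

Let digit_set (x : TR) : config d :=
  [set v : Zd d | bernoulli_digit (iter (choice.pickle v) bernoulli_shift x)].

Let measurable_digit_set : measurable_fun setT digit_set.
Proof.
apply: (@measurability _ _ _ (config d) setT digit_set (@site_events d)) => //.
move=> _ [_ [v _ <-] <-]; rewrite setTI.
rewrite (_ : _ @^-1` _ = (bernoulli_digit \o iter (choice.pickle v) bernoulli_shift) @^-1` [set true]).
  by rewrite -[X in measurable X]setTI; exact: measurable_digit_shift.
by apply/seteqP; split.
Qed.

Let law : {measure set (config d) -> \bar R} :=
  measure_function_pushforward__canonical__measure_function_Measure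
    (mrestr mu mI1) measurable_digit_set.

Let lawE (S : {fset 'rV[int]_d}) :
  law [set A : config d | forall v, v \in S -> A v] = (p ^+ #|` S|)%:E.
Proof.
pose s := [seq choice.pickle v | v <- enum_fset S].
pose n := (\max_(i <- s) i).+1.
have us : uniq s.
  by rewrite map_inj_uniq ?fset_uniq//; exact: (pcan_inj choice.pickleK).
have ltn i : i \in s -> (i < n)%N by move=> si; rewrite ltnS; exact: leq_bigmax_seq.
have -> : #|` S| = count [in s] (iota 0 n).
  rewrite -[LHS](size_map choice.pickle) -size_filter; apply/perm_size/uniq_perm => //.
    by rewrite filter_uniq// iota_uniq.
  move=> i; rewrite mem_filter mem_iota /=.
  by rewrite add0n; apply/idP/andP => [si|[]//]; split=> //; exact: ltn.
transitivity (mu (I1 `&` cyl n [in s])); last exact: lebesgue_cyl.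
rewrite setIC; congr (mu (_ `&` _)); apply/seteqP; split=> x /= H.
  by move=> i _ /mapP[v vS ->]; exact: H.
by move=> v vS; apply: H; [apply: ltn|]; exact: map_f.
Qed.

Let law_setT : law setT = 1%E.
Proof.
transitivity (law [set A : config d | forall v, v \in (fset0 : {fset 'rV[int]_d}) -> A v]).
  by congr (law _); apply/seteqP; split.
by rewrite lawE cardfs0 expr0.
Qed.
Let law_prob : probability (config d) R :=
  HB.pack (Measure.sort law) (Measure_isProbability.Build _ _ _ law law_setT).

Lemma exists_random_set_law :
  exists P : probability (config d) R, is_random_set_law p P.
Proof.
exists law_prob.
have law1 (x : Zd d) : law [set A : config d | A x] = p%:E.
  have := lawE [fset x]%fset; rewrite cardfs1 expr1 => <-.
  congr (law _); apply/seteqP; split=> A /= H; last by apply: H; rewrite inE.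
  by move=> v; rewrite inE => /eqP ->.
split=> [//|S]; under eq_bigr do rewrite law1.
rewrite prodEFin big_const_seq count_predT iter_mulr_1.
exact: (lawE S).
Qed.

End digits.

(* The law P_p; it exists and is unique for 0 <= p <= 1 (random_set_lawP,
   is_random_set_law_unique). For other p the value is meaningless. *)
Definition random_set_law (R : realType) (d : nat) (p : R) :
    probability (config d) R :=
  xget (\d_ (set0 : config d) : probability (config d) R)
    [set P : probability (config d) R | is_random_set_law p P].

Lemma random_set_lawP (R : realType) (d : nat) (p : R) : 0 <= p <= 1 ->
  is_random_set_law p (random_set_law d p).
Proof. by move=> p01; apply: xgetPex; exact: exists_random_set_law. Qed.

Lemma is_random_set_law_unique (R : realType) (d : nat) (p : R)
    (P Q : probability (config d) R) :
  is_random_set_law p P -> is_random_set_law p Q ->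
  forall E, measurable E -> P E = Q E.
Proof.
move=> [P1 PI] [Q1 QI] E mE.
pose G : set (set (config d)) := [set (\bigcap_(v in [set` S]) [set A : config d | A v]) | S in [set: {fset 'rV[int]_d}]].
apply: (@g_sigma_algebra_measure_unique _ R (config d) G _ (fun=> setT) _ _ P Q) => //.
- move=> _ [S _ <-]; apply: fin_bigcap_measurable => // v _.
  by apply: sub_sigma_algebra; exists v.
- by move=> _; exists fset0 => //; rewrite set_fset0 bigcap_set0.
- by rewrite bigcup_const.
- move=> _ _ [S _ <-] [S' _ <-]; exists (S `|` S')%fset => //.
  by rewrite set_fsetU bigcap_setU.
- move=> _ [S _ <-]; apply: etrans (PI S) (etrans _ (esym (QI S))).
  by apply: eq_bigr => v _; rewrite P1 Q1.
- by move=> _; apply: (le_lt_trans (probability_le1 P measurableT)); rewrite ltry.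
- apply: (sub_sigma_algebra2 _ mE) => _ [v _ <-]; exists [fset v]%fset => //.
  by rewrite set_fset1 bigcap_set1.
Qed.

Lemma measurable_infected (d : nat) (U : set (set (Zd d))) (t : nat)
    (x : Zd d) : update_family U ->
  measurable [set A : config d | infected U A t x].
Proof.
move=> [fU finU]; elim: t x => [|t IH] x /=.
  by apply: sub_sigma_algebra; exists x.
rewrite (_ : [set A | _] = [set A : config d | infected U A t x] `|`
  \bigcup_(X in U) \bigcap_(y in X) [set A : config d | infected U A t (x + y)]).
  apply: measurableU => //; apply: fin_bigcup_measurable => [//|X UX].
  by apply: fin_bigcap_measurable => [|y _]; [case: (finU X UX)|exact: IH].
apply/seteqP; split=> A /= [?|[X UX XA]]; [by left| |by left|]; right.
  by exists X => // y Xy; apply: XA; exists y.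
by exists X => // _ [y Xy <-]; exact: XA.
Qed.

Lemma measurable_percolation (d : nat) (U : set (set (Zd d))) :
  update_family U -> measurable [set A : config d | Uclosure U A = setT].
Proof.
move=> UU; rewrite (_ : [set A | _] =
    ~` \bigcup_x ~` \bigcup_t [set A : config d | infected U A t x]).
  apply: measurableC; apply: countable_bigcupT_measurable => // x.
  apply: measurableC; apply: bigcupT_measurable => t.
  exact: measurable_infected.
rewrite setC_bigcup; under eq_bigcapr do rewrite setCK.
apply/seteqP; split=> A /= AT.
  by move=> x _; have : [set: 'rV[int]_d] x by []; rewrite -AT.
by apply/seteqP; split=> // x _; exact: AT.
Qed.

Definition critical_probability (R : realType) (d : nat)
    (U : set (set (Zd d))) : R :=
  inf [set p : R | 0 <= p <= 1 /\
    ((2^-1)%:E <= random_set_law d p [set A : config d | Uclosure U A = setT])%E].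

Definition inner (R : realType) (d : nat) (u v : 'rV[R]_d) : R :=
  \sum_(i < d) u 0 i * v 0 i.

Definition sphere (R : realType) (d : nat) : set 'rV[R]_d :=
  [set u | inner u u = 1].

Definition half_space (R : realType) (d : nat) (u : 'rV[R]_d) : set (Zd d) :=
  [set x | inner (map_mx intr x) u < 0].

Definition stable_directions (R : realType) (d : nat) (U : set (set (Zd d))) :
    set 'rV[R]_d :=
  [set u | sphere u /\ Uclosure U (half_space u) = half_space u].

(* Open hemispheres; a closed hemisphere has the same relative interior, so that
   int (H `&` S) does not depend on the choice. *)
Definition hemisphere (R : realType) (d : nat) (v : 'rV[R]_d) : set 'rV[R]_d :=
  [set u | sphere u /\ 0 < inner u v].

Definition sphere_interior (R : realType) (d : nat) (B : set 'rV[R]_d) :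
    set 'rV[R]_d :=
  interior (B : set (subspace (@sphere R d))).

Definition subcritical (R : realType) (d : nat) (U : set (set (Zd d))) : Prop :=
  forall v : 'rV[R]_d, sphere v ->
    sphere_interior (hemisphere v `&` stable_directions U) !=set0.

(* Main.v *)
(* Perturbing stable directions generically, subcriticality and compactness of
   the sphere give finitely many linear forms L_i such that each X in U has, for
   each i, a point y with L_i y > 0, and such that every w has L_i w <= 0 for
   some i. Call G shielded if every x outside G has some i for which the points
   x + z with L_i z >= |z| / e and |z| <= r avoid G. For suitable e and r shielded
   sets are closed under infection, and narrowing the cones a little lets a
   shielded set absorb a sparse family of small balls while changing only in
   larger balls around them.

   Call a point of A crowded at scale n + 1 if it is crowded at scale n and has
   another such point at distance between a_n and b_n. Points crowded at scale n
   but not n + 1 form sparse small clusters, so, absorbing them from the largest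
   scale down to 0, a finite A lies in a shielded set each point of which is,
   for some n, within R_n of a point crowded at scale n. Hence if 0 is infected,
   some point within R_n of 0 is crowded at scale n, which forces A to contain
   one of K^(2^n) sets of 2^n points, K constant. For small p the sum over n of
   (K p)^(2^n) is below 1/2. *)
Require Import Defs.
From mathcomp Require Import all_boot all_order all_algebra.
From mathcomp Require Import finmap.
From mathcomp Require Import all_classical all_reals all_analysis.
From mathcomp Require Import zify lra.

Set Implicit Arguments.
Unset Strict Implicit.
Unset Printing Implicit Defensive.

Import Order.TTheory GRing.Theory Num.Theory.
Import numFieldNormedType.Exports.

Local Open Scope classical_set_scope.
Local Open Scope ring_scope.

(* The scales are a_n = near_radius, R_n = merge_radius and b_n = 3 R_n; the cones
   at scale n have parameter e = q^(n+1), whence the quadratic exponents. *)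
Definition near_radius (q n : nat) : nat := q ^ (3 * n * n.+1 + 1).
Definition merge_radius (q n : nat) : nat := q ^ (5 * n.+1) * near_radius q n.

Lemma near_radiusS q n : near_radius q n.+1 = (q ^ n.+1 * merge_radius q n)%N.
Proof. by rewrite /merge_radius /near_radius -!expnD; congr (_ ^ _)%N; lia. Qed.

Lemma merge_radius_scale q n : (4 <= q)%N ->
  (4 * merge_radius q n <= near_radius q n.+1)%N.
Proof.
move=> q4; rewrite near_radiusS leq_mul2r; apply/orP; right.
by rewrite expnS (leq_trans q4) // leq_pmulr // expn_gt0; lia.
Qed.

(** * Crowded points *)

Section crowded.
Context (V : zmodType) (N : V -> nat) (q : nat).

Fixpoint crowded (A : set V) (n : nat) : set V :=
  if n is m.+1 then
    [set x | crowded A m x /\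
      exists2 y, crowded A m y &
        (near_radius q m < N (x - y) <= 3 * merge_radius q m)%N]
  else A.

Lemma crowded_sub (A : set V) n : crowded A n `<=` A.
Proof. by elim: n => [//|n IH] x /= [/IH]. Qed.

Lemma crowded_mono (A B : set V) n : A `<=` B -> crowded A n `<=` crowded B n.
Proof.
move=> AB; elim: n => [//|n IH] x /= [/IH Bx [y /IH By xy]].
by split=> //; exists y.
Qed.

(** Since [near_radius q m >= 2 ^ m > m], no pair of points of [A] is far enough apart to count at
    scale [m]. So the crowding of a finite set dies out at some scale. *)
Lemma crowded_bounded (A : set V) m : (2 <= q)%N ->
  (forall x y : V, A x -> A y -> (N (x - y) <= m)%N) -> crowded A m.+1 `<=` set0.
Proof.
move=> q2 Am x /= [/crowded_sub Ax [y /crowded_sub Ay /andP[+ _]]].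
rewrite ltnNge (leq_trans (Am x y Ax Ay)) //.
apply: (@leq_trans (2 ^ m)%N); first exact/ltnW/ltn_expl.
apply: (@leq_trans (q ^ m)%N); first by case: (m) => // m'; rewrite leq_exp2r.
by rewrite leq_pexp2l //; nia.
Qed.
End crowded.

(** * Cones and shielded sets *)

Section shielding.
Context (R : realDomainType) (V : zmodType) (I : Type).
Context (N : V -> nat) (L : I -> V -> R) (C : nat).
Context (ND : forall x y : V, (N (x + y) <= N x + N y)%N).
Context (NN : forall x : V, N (- x) = N x) (N0 : N 0 = 0%N).
Context (LD : forall i, {morph L i : x y / x + y}).
Context (LC : forall i x, `|L i x| <= C%:R * (N x)%:R).
Context (Lneg : forall w, exists i, L i w <= 0).

Definition cone (e : nat) (i : I) : set V := [set z | (N z)%:R <= e%:R * L i z].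

(* If every [X] in [U] has, for each [i], a point [y] in [cone e i] with
   [N y <= r], then shielded sets are closed under the infection rule. *)
Definition shielded (e r : nat) (G : set V) : Prop :=
  forall x, ~ G x ->
    exists i, forall z, (N z <= r)%N -> cone e i z -> ~ G (x + z).

Lemma cone_add e i x y : cone e i x -> cone e i y -> cone e i (x + y).
Proof.
rewrite /cone /= LD mulrDr => hx hy; apply: le_trans (lerD hx hy).
by rewrite -natrD ler_nat.
Qed.

Lemma cone0 e i : cone e i 0.
Proof.
have L0 : L i 0 = 0 by apply: (addrI (L i 0)); rewrite -LD !addr0.
by rewrite /cone /= N0 L0 mulr0.
Qed.

Lemma cone_le e e' i : (e <= e')%N -> cone e i `<=` cone e' i.
Proof.
move=> ee' z; rewrite /cone /= => h; apply: (le_trans h).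
case: (posnP e) => e0.
  (* A cone of parameter 0 contains only vectors of norm 0, on which [LC] makes [L i] vanish. *)
  move: h; rewrite e0 mul0r lern0 => /eqP Nz0.
  by have := LC i z; rewrite Nz0 mulr0 normr_le0 => /eqP ->; rewrite mulr0.
rewrite ler_wpM2r ?ler_nat //.
by rewrite -(@pmulr_rge0 _ e%:R) ?ltr0n //; apply: le_trans h; rewrite ler0n.
Qed.

Lemma N_sub_triangle (x y z : V) : (N (x - z) <= N (x - y) + N (y - z))%N.
Proof. by have := ND (x - y) (y - z); rewrite addrA subrK. Qed.

Lemma N_subC (x y : V) : N (x - y) = N (y - x).
Proof. by rewrite -NN opprB. Qed.

Lemma N_addB (x z c : V) : (N (x + z - c) <= N (x - c) + N z)%N.
Proof. by rewrite addrAC. Qed.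

Lemma N_sub_add (x z c : V) : (N (x - c) <= N z + N (x + z - c))%N.
Proof.
have -> : x - c = - z + (x + z - c) by rewrite [RHS]addrC addrAC addrK.
by rewrite -(NN z); exact: ND.
Qed.

(** * Absorbing separated balls at one scale *)

Section one_scale.
Context (e k a S M r r' : nat) (G P : set V).
Context (k2 : (2 <= k)%N) (rS : (r * 2 <= S)%N) (aS : (C * e * a + a < S)%N).
Context (SM : (S <= M)%N).
Context (aM : (a + 2 * (1 + e * C) * (a + 2 * S) <= M)%N).
Context (Mr' : (4 * M <= r')%N).
Context (Gsh : shielded (k * e) r' G).
Context (Psep : forall c c', P c -> P c' -> (N (c - c') < 3 * M)%N -> c = c').

Let near_G (c : V) := exists2 g, G g & (N (g - c) <= 2 * S)%N.
(** When [G] comes near [c], the zone is so large that a vector from its outside to the ball is long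
    compared with the distance from the ball to [G]. Otherwise it is so small that [G] does not meet
    the ball of twice its radius. *)
Let rho (c : V) : nat := if `[< near_G c >] then M else S.
Let free (c x : V) (i : I) := forall z, cone e i z -> (N (x + z - c) <= 2 * rho c)%N ->
  ~ G (x + z) /\ (a < N (x + z - c))%N.
Let zone (c x : V) := (N (x - c) < rho c)%N.

Let rho_le c : (rho c <= M)%N.
Proof. by rewrite /rho; case: ifP. Qed.

Let rho_ge c : (S <= rho c)%N.
Proof. by rewrite /rho; case: ifP. Qed.

(* Near [G] the shield of [G] at [x] also avoids the ball, since a ball met by
   the narrow cone would put a point of [G] in the wider one; away from [G] a
   direction pointing away from [c] does. *)
Let free_outside (c x : V) : P c -> ~ G x -> ~ zone c x -> (N (x - c) < rho c + r)%N ->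
  exists i, free c x i.
Proof.
move=> Pc nGx; rewrite /zone /free /rho; case: asboolP => [[g Gg gc]|nnear] /negP.
  rewrite -leqNgt => Mx xM; have [i hi] := Gsh nGx; exists i => z kz zc.
  have Nz : (N z <= r')%N.
    have := N_sub_triangle (x + z) c x; rewrite addrAC subrr add0r (N_subC c).
    by lia.
  have kz' : cone (k * e) i z by apply: cone_le kz; rewrite leq_pmull //; lia.
  split; first exact: hi.
  rewrite ltnNge; apply/negP => za.
  pose h := g - (x + z).
  have Nh : (N h <= a + 2 * S)%N.
    by have := N_sub_triangle g c (x + z); rewrite (N_subC c) -/h; lia.
  have gE : g = x + (z + h) by rewrite /h addrA addrC subrK.
  apply: (hi (z + h)); last by rewrite -gE.
    have -> : z + h = g - x by rewrite gE addrAC subrr add0r.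
    by have := N_sub_triangle g c x; rewrite (N_subC c x); lia.
  have Nzlow : (M <= a + N z)%N.
    have := N_sub_add x z c; lia.
  (* Replacing [z] by [z + h] costs at most [k e C (a + 2 S)] in [k e L i] and [a + 2 S] in norm.
     The factor [k] pays for both: as [k >= 2], [(k - 1) N z] is at least [k N z / 2], and [aM]
     bounds [N z] below by [2 (1 + e C) (a + 2 S)]. *)
  have key : (k * (1 + e * C) * (a + 2 * S) + N z <= k * N z)%N.
    rewrite -mulnA; move: aM; rewrite -mulnA.
    move: ((1 + e * C) * (a + 2 * S))%N => Q QM.
    have QN : (2 * Q <= N z)%N by lia.
    have := leq_mul k2 (leqnn (N z)); have := leq_mul (leqnn k) QN.
    by lia.
  rewrite /cone /= LD mulrDr.
  have Lh : - (C%:R * (a + 2 * S)%:R) <= L i h.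
    have := LC i h; rewrite ler_norml => /andP[+ _]; apply: le_trans.
    by rewrite lerN2 ler_wpM2l // ?ler_nat.
  have -> : (k * e)%:R * L i z = k%:R * (e%:R * L i z) by rewrite natrM mulrA.
  have h1 : k%:R * (N z)%:R <= k%:R * (e%:R * L i z) by rewrite ler_wpM2l.
  have h2 : - ((k * e)%:R * (C%:R * (a + 2 * S)%:R)) <= (k * e)%:R * L i h.
    by rewrite -mulrN ler_wpM2l.
  apply: le_trans (lerD h1 h2).
  rewrite -!natrM lerBrDr -natrD ler_nat.
  have := ND z h; have : (1 <= k)%N by lia.
  by nia.
rewrite -leqNgt => Sx xS; have [i Li] := Lneg (c - x); exists i => z kz zc.
split; first by move=> Gz; apply: nnear; exists (x + z).
rewrite ltnNge; apply/negP => za; move: kz; rewrite /cone /=.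
(* As [L i (c - x) <= 0], a vector [z] from [x] into the ball has [L i z <= C a], while its norm is
   at least [S - a > C e a]; so it is not in the cone. *)
pose j := x + z - c.
have zE : z = (c - x) + j by rewrite [RHS]addrC /j addrA subrK addrAC subrr add0r.
have Lz : L i z <= C%:R * a%:R.
  rewrite zE LD -[leRHS]add0r lerD //.
  have := LC i j; rewrite ler_norml => /andP[_]; move/le_trans; apply.
  by rewrite ler_wpM2l // ler_nat.
have Nz : (S <= a + N z)%N.
  have := N_sub_add x z c; lia.
move=> h; have : (N z)%:R <= e%:R * (C%:R * a%:R) :> R.
  by apply: (le_trans h); rewrite ler_wpM2l.
by rewrite -!natrM ler_nat; nia.
Qed.

Lemma shielded_absorb : exists G' : set V,
  [/\ shielded e r G', G `<=` G',
      forall c x : V, P c -> (N (x - c) <= a)%N -> G' x &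
      forall x, G' x -> G x \/ exists2 c, P c & (N (x - c) <= M)%N].
Proof.
(* All points removed near [c] are shielded by a cone free both of [G] and of
   the ball around [c]; away from the centers [G'] agrees with [G]. *)
pose G' := [set x | (exists c, [/\ P c, zone c x & ~ exists i, free c x i])
                  \/ (G x /\ ~ exists2 c, P c & zone c x)].
have zone_uniq (c c' x : V) : P c -> P c' -> (N (x - c) < 2 * rho c)%N ->
    zone c' x -> c = c'.
  move=> Pc Pc' xc; rewrite /zone => xc'; apply: Psep => //.
  have := N_sub_triangle c x c'; rewrite (N_subC c x).
  by have := rho_le c; have := rho_le c'; lia.
have free_shift (c x : V) i : P c -> (N (x - c) < rho c + r)%N -> free c x i ->
    forall z, (N z <= r)%N -> cone e i z -> ~ G' (x + z).
  move=> Pc xc fx z zr kz.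
  (* [2 r <= S <= rho c] keeps [x + z] in the range where [free c x i] applies. *)
  have yc : (N (x + z - c) < 2 * rho c)%N.
    by have := N_addB x z c; have := rho_ge c; move: rS; lia.
  have [nGy ya] := fx z kz (ltnW yc).
  case=> [[c' [Pc' zc' nf]]|[//]].
  have cc' : c = c' by exact: (zone_uniq _ _ (x + z)).
  (* Freedom is inherited along the cone: by additivity [x + z] is free in the direction [i] of
     [x]. *)
  apply: nf; exists i; rewrite -cc' => w kw; rewrite -(addrA x z w) => h.
  by apply: fx => //; exact: cone_add.
exists G'; split.
- move=> x nG'x.
  have [[c Pc zc]|nz] := pselect (exists2 c, P c & zone c x).
    have [[i fi]|nf] := pselect (exists i, free c x i).
      by exists i; apply: (free_shift c) => //; apply: (leq_trans zc); rewrite leq_addr.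
    by case: nG'x; left; exists c.
  have nGx : ~ G x by move=> Gx; apply: nG'x; right.
  (* From within [r] of a zone the cone at [x] may enter it, so a free direction is used; farther
     out the shield of [G] suffices. *)
  have [[c Pc zc]|nz'] := pselect (exists2 c, P c & (N (x - c) < rho c + r)%N).
    have [|i fi] := @free_outside c x Pc nGx _ zc; first by move=> ?; apply: nz; exists c.
    by exists i; exact: (free_shift c).
  have [i hi] := Gsh nGx; exists i => z zr kz.
  have SM' := SM; have rS' := rS.
  case=> [[c [Pc zc _]]|[Gy _]]; last first.
    apply: (hi z) => //; first by lia.
    by apply: cone_le kz; rewrite leq_pmull //; lia.
  apply: nz'; exists c => //; move: zc; rewrite /zone.
  have := N_sub_add x z c; lia.
- move=> x Gx; have [[c Pc zc]|nz] := pselect (exists2 c, P c & zone c x); last by right.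
  left; exists c; split=> // -[i fi].
  (* The apex lies in its own cone, so a free point is neither in [G] nor in the ball. Hence points
     of [G] in a zone are kept, and likewise those of the ball below. *)
  have [|] := fi 0 (cone0 _ _); rewrite addr0 //.
  by move: zc; rewrite /zone; lia.
- move=> c x Pc xa; left; exists c.
  have zc : zone c x by rewrite /zone; have := rho_ge c; lia.
  split=> // -[i fi]; have [|_] := fi 0 (cone0 _ _); rewrite addr0.
    by move: zc; rewrite /zone; lia.
  by lia.
- move=> x [[c [Pc zc _]]|[Gx _]]; last by left.
  by right; exists c => //; move: zc; rewrite /zone; have := rho_le c; lia.
Qed.
End one_scale.

(** The gap between [a] and [b] makes being within [a] an equivalence relation on [D]; [P] takes one
    point of each class. *)
Lemma separated_centers (D : set V) (a b : nat) : (3 * a <= b)%N ->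
  (forall x y : V, D x -> D y -> (N (x - y) <= a)%N \/ (b < N (x - y))%N) ->
  exists P : set V,
    [/\ P `<=` D,
        forall c c' : V, P c -> P c' -> (N (c - c') <= b)%N -> c = c' &
        forall x : V, D x -> exists2 c, P c & (N (x - c) <= a)%N].
Proof.
move=> ab Dab; pose block (x : V) : set V := [set y | D y /\ (N (x - y) <= a)%N].
pose pick (x : V) : V := xget 0 (block x).
have blockP x : D x -> block x (pick x).
  by move=> Dx; apply: xgetPex; exists x; rewrite /block /= subrr N0.
have block_sub (x y : V) : D x -> D y -> (N (x - y) <= a)%N -> block x `<=` block y.
  move=> Dx Dy xy z [Dz xz]; split=> //; case: (Dab _ _ Dy Dz) => // yz.
  by have := N_sub_triangle y x z; rewrite (N_subC y x); lia.
exists [set pick x | x in D]; split.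
- by move=> _ [x Dx <-]; case: (blockP x Dx).
- move=> _ _ [x Dx <-] [y Dy <-] cc'.
  have [Dc xc] := blockP x Dx; have [Dc' yc'] := blockP y Dy.
  have {}cc' : (N (pick x - pick y) <= a)%N.
    by case: (Dab _ _ Dc Dc') => // ; rewrite ltnNge cc'.
  have xy : (N (x - y) <= a)%N.
    case: (Dab _ _ Dx Dy) => // xy.
    have := N_sub_triangle x (pick x) y.
    have := N_sub_triangle (pick x) (pick y) y.
    by rewrite (N_subC (pick y) y); lia.
  (* The choice made by [xget] depends only on the class as a set. *)
  congr (xget _ _); apply/seteqP; split; apply: block_sub => //.
  by rewrite N_subC.
- by move=> x Dx; exists (pick x); [exists x|case: (blockP x Dx)].
Qed.

(** * Descent through the scales *)

Section all_scales.
Context (q : nat) (q16 : (16 <= q)%N) (Cq : (C < q)%N).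

Lemma shielded_descend n (A G : set V) :
  shielded (q ^ n.+2) (4 * merge_radius q n) G -> crowded N q A n.+1 `<=` G ->
  exists G', [/\ shielded (q ^ n.+1) (near_radius q n) G', crowded N q A n `<=` G' &
    forall x, G' x -> G x \/
      exists2 c, crowded N q A n c & (N (x - c) <= merge_radius q n)%N].
Proof.
move=> Gsh EG.
set a := near_radius q n; set M := merge_radius q n; set e := (q ^ n.+1)%N.
have a_gt0 : (0 < a)%N by rewrite /a /near_radius expn_gt0; lia.
have qe : (q <= e)%N by rewrite /e expnS leq_pmulr // expn_gt0; lia.
have ME : M = (e ^ 5 * a)%N by rewrite /M /merge_radius /e -expnM (mulnC 5).
(* This is the room that [aM] requires: for [S = (C e + 2) a] and [C < e], both [1 + e C] and
   [(a + 2 S) / (2 a)] are at most [e ^ 2]. *)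
have e4 : (4 * e ^ 4 * a + 2 * a <= M)%N.
  rewrite ME -mulnDl leq_mul2r; apply/orP; right; rewrite (expnS e 4).
  have : (0 < e ^ 4)%N by rewrite expn_gt0; lia.
  by nia.
have eE : (4 * e ^ 4 * a = 4 * (e * e) * (e * e) * a)%N by rewrite !expnS; nia.
have e1 : (1 + e * C <= e * e)%N by nia.
have e2 : (2 * C * e + 5 <= 2 * (e * e))%N by nia.
pose D := crowded N q A n `\` crowded N q A n.+1.
have [|x y [Dx nDx] [Dy nDy]|P [PD Psep Pcov]] := @separated_centers D a (3 * M).
- by lia.
- case: (leqP (N (x - y)) a) => xya; [by left|right; rewrite ltnNge; apply/negP => xyM].
  by apply: nDx; split=> //; exists y => //; rewrite xya.
have [||||||||G' [G'sh GG' PG' G'G]] :=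
  @shielded_absorb e q a ((C * e + 2) * a) M a (4 * M) G P.
- by lia.
- by nia.
- by nia.
- apply: leq_trans e4; rewrite eE.
  have h : (C * e + 2 <= 2 * (e * e))%N by lia.
  have := leq_mul h (leqnn a); have : (0 < e * e)%N by rewrite muln_gt0; lia.
  by nia.
- apply: leq_trans e4; rewrite eE.
  have h3 : ((2 * C * e + 5) * a <= 2 * (e * e) * a)%N by rewrite leq_mul2r e2 orbT.
  have -> : (a + 2 * ((C * e + 2) * a) = (2 * C * e + 5) * a)%N by lia.
  have := leq_mul e1 h3; lia.
- by [].
- by rewrite /e -expnS.
- move=> c c' Pc Pc' cc'; apply: Psep => //; exact: ltnW.
exists G'; split=> //.
- move=> x Enx; have [nDx|Dx] := pselect (crowded N q A n.+1 x); first exact/GG'/EG.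
  by have [|c Pc xc] := Pcov x; [split|exact: (PG' c)].
- by move=> x /G'G[|[c /PD[Enc _] xc]]; [left|right; exists c].
Qed.

Lemma shielded_cover (A : set V) m : crowded N q A m `<=` set0 ->
  exists G, [/\ shielded q q G, A `<=` G &
    forall x, G x -> exists n, exists2 y, crowded N q A n y &
      (N (x - y) <= merge_radius q n)%N].
Proof.
move=> Em0; suff : forall k n, (n + k = m)%N -> exists G,
    [/\ shielded (q ^ n.+1) (near_radius q n) G, crowded N q A n `<=` G &
      forall x, G x -> exists n, exists2 y, crowded N q A n y &
        (N (x - y) <= merge_radius q n)%N].
  (* At scale 0 both [q ^ 1] and [near_radius q 0] reduce to [q]. *)
  by move=> /(_ m 0%N erefl).
elim=> [|k IH] n nkm.
  have {nkm} -> : n = m by lia.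
  (* The descent starts from the empty set, shielded by any index; [Lneg 0] supplies one. *)
  exists set0; split=> // x _; have [i _] := Lneg 0.
  by exists i => z _ _ [].

have [|G [Gsh EG Gcov]] := IH n.+1; first by lia.
have [|G' [G'sh EG' G'G]] := @shielded_descend n A G _ EG.
- move=> x nGx; have [i hi] := Gsh x nGx; exists i => z zr; apply: hi.
  by apply: leq_trans zr (merge_radius_scale n _); lia.
- exists G'; split=> // x /G'G[/Gcov //|[y Eny xy]].
  by exists n, y.
Qed.

End all_scales.
End shielding.

(** * Counting witness sets *)

Section witnesses.
Context (d : nat).
Local Notation Z := 'rV[int]_d.

Definition sup_norm (x : Z) : nat := (\max_(i < d) `|x ord0 i|)%N.

Lemma sup_norm_leP (x : Z) m :
  reflect (forall i, (`|x ord0 i| <= m)%N) (sup_norm x <= m)%N.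
Proof. by apply: (iffP (bigmax_leqP _ _ _)) => h i; [apply: h|move=> _; apply: h]. Qed.

Lemma leq_sup_norm (x : Z) i : (`|x ord0 i| <= sup_norm x)%N.
Proof. exact: (sup_norm_leP _ _ (leqnn _)). Qed.

Lemma sup_normD (x y : Z) : (sup_norm (x + y) <= sup_norm x + sup_norm y)%N.
Proof.
apply/sup_norm_leP => i.
have -> : (x + y) ord0 i = (x ord0 i + y ord0 i :> int) by rewrite mxE.
by have := leq_sup_norm x i; have := leq_sup_norm y i; lia.
Qed.

Lemma sup_normN (x : Z) : sup_norm (- x) = sup_norm x.
Proof. by apply: eq_bigr => i _; rewrite mxE abszN. Qed.

Lemma sup_norm0 : sup_norm 0 = 0%N.
Proof. by apply/eqP; rewrite -leqn0; apply/sup_norm_leP => i; rewrite mxE. Qed.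

Lemma sup_norm_distC (x y : Z) : sup_norm (x - y) = sup_norm (y - x).
Proof. by rewrite -sup_normN opprB. Qed.

Definition ball_seq (m : nat) : seq Z :=
  [seq \row_i ((f i : nat)%:Z - m%:Z) | f : {ffun 'I_d -> 'I_(2 * m + 1)}].

Lemma size_ball_seq m : size (ball_seq m) = ((2 * m + 1) ^ d)%N.
Proof. by rewrite size_map -cardE card_ffun !card_ord. Qed.

Lemma mem_ball_seq m (x : Z) : (sup_norm x <= m)%N -> x \in ball_seq m.
Proof.
move=> /sup_norm_leP xm.
have lt i : (`|(x ord0 i + m%:Z)%R| < 2 * m + 1)%N by have := xm i; lia.
apply/mapP; exists [ffun i => Ordinal (lt i)]; first by rewrite mem_enum.
by apply/rowP => i; rewrite mxE ffunE /= gez0_abs ?addrK //; have := xm i; lia.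
Qed.

Context (q : nat).

(* The [2 ^ n]-point sets whose presence in [A] forces [x] to be [crowded] at
   scale [n]. *)
Fixpoint witnesses (n : nat) (x : Z) : seq {fset Z} :=
  if n is m.+1 then
    flatten [seq [seq (T1 `|` T2)%fset | T1 <- witnesses m x, T2 <- witnesses m (x + z)]
            | z <- [seq z <- ball_seq (3 * merge_radius q m) |
                    (near_radius q m < sup_norm z <= 3 * merge_radius q m)%N]]
  else [:: [fset x]%fset].

Lemma crowded_witness (A : set Z) n x : crowded sup_norm q A n x ->
  exists2 T, T \in witnesses n x & forall t, t \in T -> A t.
Proof.
elim: n x => [|n IH] x /=.
  by exists [fset x]%fset; rewrite ?inE // => t; rewrite inE => /eqP ->.
move=> [/IH [T1 Tx TA1] [y /IH [T2 Ty TA2] xy]].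
exists (T1 `|` T2)%fset; last by move=> t; rewrite inE => /orP[/TA1|/TA2].
have yE : y = x + (y - x) by rewrite addrC subrK.
apply/flattenP; exists [seq (T1 `|` T2)%fset | T1 <- witnesses n x, T2 <- witnesses n y].
  apply/mapP; exists (y - x); last by rewrite -yE.
  move: xy; rewrite sup_norm_distC => xy.
  by rewrite mem_filter xy mem_ball_seq //; case/andP: xy.
by apply/allpairsP; exists (T1, T2).
Qed.

Context (q16 : (16 <= q)%N).

Lemma near_le_merge n : (near_radius q n <= merge_radius q n)%N.
Proof. by rewrite leq_pmull // expn_gt0; lia. Qed.

(** The diameter bound carries the induction. The two halves lie within less than [a_n / 2] of base
    points more than [a_n] apart, so they are disjoint. The bound persists because
    [6 R_n + a_n <= 7 R_n < 16 R_n <= a_(n+1)]. *)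
Lemma witness_card n x T : T \in witnesses n x ->
  #|` T| = (2 ^ n)%N /\ forall t, t \in T -> (2 * sup_norm (t - x)%R < near_radius q n)%N.
Proof.
elim: n x T => [|n IH] x T /=.
  rewrite inE => /eqP ->; rewrite cardfs1; split=> // t; rewrite inE => /eqP ->.
  by rewrite subrr sup_norm0 /near_radius expn_gt0; lia.
move=> /flattenP[_ /mapP[z + ->]]; rewrite mem_filter => /andP[/andP[za zb] _].
move=> /allpairsP[[T1 T2]] /= [Sx S'x ->].
have [cS dS] := IH _ _ Sx; have [cS' dS'] := IH _ _ S'x.
have dist (t : Z) : (sup_norm (t - x) <= sup_norm (t - (x + z)) + sup_norm z)%N.
  have -> : t - x = t - (x + z) + z by rewrite opprD addrA subrK.
  exact: sup_normD.
split.
  rewrite cardfsU cS cS' (_ : _ `&` _ = fset0)%fset ?cardfs0 ?subn0.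
    by rewrite expnS; lia.
  apply/fsetP => t; rewrite !inE; apply/negP => /andP[/dS tx /dS' txz].
  have : (sup_norm z <= sup_norm (t - x) + sup_norm (t - (x + z)))%N.
    rewrite -(sup_normN (t - (x + z))).
    have {1}-> : z = (t - x) - (t - (x + z)) by rewrite opprB [RHS]addrC addrA subrK addrAC subrr add0r.
    exact: sup_normD.
  by lia.
move=> t tT.
have q2 : (16 <= q ^ n.+1)%N.
  by apply: (leq_trans q16); rewrite expnS leq_pmulr // expn_gt0; lia.
have := near_le_merge n; rewrite near_radiusS.
have := leq_mul q2 (leqnn (merge_radius q n)).
move: tT; rewrite inE => /orP[/dS|/dS']; first by lia.
by have := dist t; lia.
Qed.

Lemma size_ball_scale n m : (m <= 3 * merge_radius q n)%N ->
  (size (ball_seq m) <= (q ^ (8 * d)) ^ (n.+1 ^ 2))%N.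
Proof.
move=> mn; rewrite size_ball_seq.
have -> : ((q ^ (8 * d)) ^ (n.+1 ^ 2) = (q ^ (8 * n.+1 ^ 2)) ^ d)%N.
  by rewrite -!expnM; congr (_ ^ _)%N; lia.
have M0 : (0 < merge_radius q n)%N by rewrite muln_gt0 !expn_gt0; lia.
have qM : (2 * m + 1 <= q ^ (8 * n.+1 ^ 2))%N.
  apply: (@leq_trans (q * merge_radius q n)); first by nia.
  (* The exponents compare as [3 n^2 + 8 n + 7 <= 8 (n + 1)^2]. *)
  rewrite /merge_radius /near_radius -!expnD -expnS leq_pexp2l; nia.
by case: (posnP d) => [->//|d0]; rewrite leq_exp2r.
Qed.

(** With [D = q ^ (8 d)], the bounds satisfy [c_(n+1) = D^((n+1)^2) c_n^2]. The exponent
    [f n = (n+1)^2 + 2 (n+1) + 3] solves [f (n+1) + (n+1)^2 = 2 f n], so [c_n D^(f n)] is squared at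
    each step, and [f 0 = 6]. The spare factor [D^(f n)] later absorbs the choice of the base
    point. *)
Lemma size_witnesses n : exists c : nat, (forall x, (size (witnesses n x) <= c)%N) /\
  (c * (q ^ (8 * d)) ^ (n.+1 ^ 2 + 2 * n.+1 + 3) <= (q ^ (8 * d)) ^ (6 * 2 ^ n))%N.
Proof.
move: (fun n => @size_ball_scale n _ (leqnn _)).
set D := (q ^ (8 * d))%N => size_ball; elim: n => [|n [c [wc cD]]].
  by exists 1%N; split=> //; rewrite mul1n muln1 leqnn.
exists (D ^ (n.+1 ^ 2) * (c * c))%N; split=> [x /=|].
  set s := [seq z <- _ | _].
  apply: (@leq_trans (size s * (c * c))).
    elim: s => [//|z s IH] /=; rewrite size_cat size_allpairs mulSn leq_add //.
    exact: leq_mul.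
  rewrite leq_mul2r; apply/orP; right; apply: leq_trans (size_ball n).
  by rewrite size_filter count_size.
have -> : (6 * 2 ^ n.+1 = 6 * 2 ^ n + 6 * 2 ^ n)%N by rewrite expnS; lia.
rewrite (expnD D (6 * 2 ^ n)); apply: leq_trans (leq_mul cD cD).
rewrite mulnAC -expnD mulnACA -expnD mulnC leq_mul2l; apply/orP; right.
by apply: eq_leq; congr (_ ^ _)%N; lia.
Qed.

Definition scale_witnesses n : seq {fset Z} :=
  flatten [seq witnesses n y | y <- ball_seq (merge_radius q n)].

Lemma size_scale_witnesses n :
  (size (scale_witnesses n) <= (q ^ (8 * d)) ^ (6 * 2 ^ n))%N.
Proof.
have [c [wc cD]] := size_witnesses n.
apply: (@leq_trans (size (ball_seq (merge_radius q n)) * c)).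
  rewrite /scale_witnesses; elim: ball_seq => [//|y s IH] /=.
  by rewrite size_cat mulSn leq_add.
apply: leq_trans cD; rewrite mulnC leq_mul2l; apply/orP; right.
apply: leq_trans (@size_ball_scale n _ _) _; first by lia.
by rewrite leq_pexp2l ?expn_gt0; lia.
Qed.
End witnesses.

(** * Probability estimates *)

Section random_set.
Context (R : realType) (d : nat) (p : R) (P : probability (config d) R).
Context (Pp : is_random_set_law p P).
Local Notation Z := 'rV[int]_d.

Definition contains (T : {fset Z}) : set (config d) :=
  [set A : config d | forall t, t \in T -> A t].

Lemma containsE T : contains T = \bigcap_(t in [set` T]) [set A : config d | A t].
Proof. by apply/seteqP; split. Qed.

Lemma measurable_site (x : Z) : measurable [set A : config d | A x].
Proof. by apply: sub_sigma_algebra; exists x. Qed.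

Lemma measurable_contains T : measurable (contains T).
Proof.
by rewrite containsE; apply: fin_bigcap_measurable => // t _; exact: measurable_site.
Qed.

Lemma law_contains T : P (contains T) = (p ^+ #|` T|)%:E.
Proof.
case: Pp => P1 PI; rewrite containsE; apply: (etrans (PI T)).
under eq_bigr do rewrite P1.
by rewrite prodEFin big_const_seq count_predT iter_mulr_1.
Qed.

Definition contains_some (s : seq {fset Z}) : set (config d) :=
  [set A : config d | exists2 T, T \in s & contains T A].

Lemma contains_some_cons T s : contains_some (T :: s) = contains T `|` contains_some s.
Proof.
apply/seteqP; split=> A.
  by case=> T'; rewrite inE => /orP[/eqP ->|]; [left|right; exists T'].
by case=> [TA|[T' T's TA]]; [exists T|exists T']; rewrite ?inE ?eqxx ?T's ?orbT.
Qed.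

Lemma contains_some_nil : contains_some [::] = set0.
Proof. by apply/seteqP; split=> A // -[]. Qed.

Lemma measurable_contains_some s : measurable (contains_some s).
Proof.
elim: s => [|T s IH]; first by rewrite contains_some_nil.
by rewrite contains_some_cons; apply: measurableU => //; exact: measurable_contains.
Qed.

Lemma law_contains_some (s : seq {fset Z}) k : (forall T, T \in s -> #|` T| = k) ->
  (P (contains_some s) <= ((size s)%:R * p ^+ k)%:E)%E.
Proof.
elim: s => [|T s IH] sk; first by rewrite contains_some_nil measure0 mul0r.
rewrite contains_some_cons.
apply: (le_trans (measureU2 _ (measurable_contains T) (measurable_contains_some s))).
have -> : (size (T :: s))%:R * p ^+ k = (size s)%:R * p ^+ k + p ^+ k.
  by rewrite /= -natr1 mulrDl mul1r.
rewrite EFinD addeC leeD //.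
  by have /eqP := law_contains T; rewrite sk ?mem_head // eq_le => /andP[].
by apply: IH => T' T's; apply: sk; rewrite inE T's orbT.
Qed.

(** By the union bound scale [n] contributes at most [(c p)^(2^n) <= 8^-(n+1) <= 4^-1 2^-(n+1)], for
    a total of at most [1/4]. *)
Lemma law_scales_lt (c : nat) (s : nat -> seq {fset Z}) (E : set (config d)) :
  0 <= p -> (8 * c)%:R * p <= 1 ->
  (forall n, size (s n) <= c ^ (2 ^ n))%N ->
  (forall n T, T \in s n -> #|` T| = (2 ^ n)%N) ->
  measurable E -> E `<=` \bigcup_n contains_some (s n) ->
  (P E < (2^-1)%:E)%E.
Proof.
move=> p0 cp sc sT mE Es.
apply: (@le_lt_trans _ _ (4^-1)%:E); last by rewrite lte_fin; lra.
apply: le_trans (measure_sigma_subadditive _ (fun n => measurable_contains_some _) mE Es) _.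
apply: le_trans (@epsilon_trick0 R 4^-1 xpredT _); last by rewrite invr_ge0.
apply: lee_nneseries => [n _ _|n _]; first exact: measure_ge0.
apply: (le_trans (law_contains_some (sT n))); rewrite lee_fin.
have cp0 : 0 <= c%:R * p by rewrite mulr_ge0.
have cp8 : c%:R * p <= 8^-1.
  by rewrite -[_^-1]mul1r ler_pdivlMr // mulrC mulrA -natrM.
apply: (@le_trans _ _ ((c%:R * p) ^+ (2 ^ n))).
  by rewrite exprMn -natrX ler_wpM2r ?exprn_ge0 // ler_nat.
apply: (@le_trans _ _ ((8^-1) ^+ (2 ^ n))); first by rewrite lerXn2r // nnegrE ?invr_ge0.
apply: (@le_trans _ _ ((8^-1) ^+ n.+1)).
  by rewrite ler_wiXn2l ?invr_ge0 ?invf_le1 // ?ler1n //; exact: ltn_expl.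
have -> : 8 = 4 * 2 :> R by rewrite -natrM.
rewrite invfM exprMn natrX -exprVn ler_wpM2r ?exprn_ge0 ?invr_ge0 //.
by rewrite exprS ler_piMr ?invr_ge0 // exprn_ile1 ?invr_ge0 ?invf_le1 // ler1n.
Qed.
End random_set.

(** This makes the set defining the critical probability non-empty, so that a lower bound of the set
    bounds its infimum. The complement is covered by the null events that a given site is missing,
    enumerated through [pickle]. *)
Lemma percolation_law1 (R : realType) (d : nat) (U : set (set 'rV[int]_d)) :
  update_family U ->
  random_set_law d (1 : R) [set A : config d | Uclosure U A = setT] = 1%E.
Proof.
move=> UU; set P := random_set_law d 1.
have [P1 _] : is_random_set_law 1 P by apply: random_set_lawP; rewrite ler01 lexx.
have mE := measurable_percolation UU.
pose F n : set (config d) :=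
  if choice.unpickle n is Some x then ~` [set A : config d | A x] else set0.
have mF n : measurable (F n).
  by rewrite /F; case: choice.unpickle => // x; apply: measurableC; exact: measurable_site.
have F0 n : P (F n) = 0%E.
  rewrite /F; case: choice.unpickle => [x|]; last exact: measure0.
  by rewrite probability_setC ?P1 ?subee //; exact: measurable_site.
rewrite -[X in P X]setCK probability_setC; last exact: measurableC.
rewrite (_ : P _ = 0%E) ?sube0 //; apply/eqP; rewrite eq_le measure_ge0 andbT.
apply: le_trans (measure_sigma_subadditive P mF (measurableC mE) _) _.
  move=> A /= nA; apply: contrapT => nF; apply: nA.
  apply/seteqP; split=> // x _; exists 0%N => //=.
  apply: contrapT => nAx; apply: nF; exists (choice.pickle x) => //.
  by rewrite /F choice.pickleK.
by rewrite eseries0 // => n _ _; exact: F0.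
Qed.

Lemma finite_uniform (T : choiceType) (D : set T) (Q : T -> nat -> Prop) :
  finite_set D -> (forall x m n, (m <= n)%N -> Q x m -> Q x n) ->
  (forall x, D x -> exists n, Q x n) -> exists n, forall x, D x -> Q x n.
Proof.
move=> /finite_seqP[s ->] mono; elim: s => [|x s IH] ex; first by exists 0%N.
have [|n hn] := IH; first by move=> y ys; apply: ex; rewrite /= inE ys orbT.
have [m hm] : exists m, Q x m by apply: ex; exact: mem_head.
exists (maxn m n) => y /=; rewrite inE => /orP[/eqP ->|/hn].
  by apply: mono hm; exact: leq_maxl.
by apply: mono; exact: leq_maxr.
Qed.

(** * Monotonicity and compactness of the closure *)

Section closure.
Context (d : nat) (U : set (set 'rV[int]_d)).
Local Notation Z := 'rV[int]_d.

Lemma infected_mono (A B : set Z) t : A `<=` B -> infected U A t `<=` infected U B t.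
Proof.
move=> AB; elim: t => [//|t IH] x /= [/IH|[X UX XA]]; first by left.
by right; exists X => // y /XA /IH.
Qed.

Lemma Uclosure_sub (A G : set Z) : A `<=` G ->
  (forall x X, U X -> (forall y, X y -> G (x + y)) -> G x) -> Uclosure U A `<=` G.
Proof.
move=> AG Gcl x [t _]; elim: t x => [|t IH] x /=; first exact: AG.
move=> [/IH //|[X UX XA]]; apply: (Gcl _ _ UX) => y Xy; apply: IH; apply: XA.
by exists y.
Qed.

(** Each infection step uses a finite rule, so an infection at time [t] traces back to finitely many
    initial sites. *)
Lemma Uclosure_compact (A : set Z) x : update_family U -> Uclosure U A x ->
  exists B, [/\ finite_set B, B `<=` A & Uclosure U B x].
Proof.
move=> [_ Ufin] [t _]; suff : infected U A t x ->
    exists B, [/\ finite_set B, B `<=` A & infected U B t x].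
  by move=> h /h[B [fB BA Bx]]; exists B; split=> //; exists t.
elim: t x => [|t IH] x /=.
  move=> Ax; exists [set x]; split=> //.
  by move=> y ->.
move=> [/IH[B [fB BA Bx]]|[X UX XA]]; first by exists B; split=> //; left.
have [Xfin _ _] := Ufin X UX.
have /choice[f fP] : forall y, exists B : set Z, X y ->
    [/\ finite_set B, B `<=` A & infected U B t (x + y)].
  move=> y; have [Xy|nXy] := pselect (X y); last by exists set0.
  by have [|B BP] := IH (x + y); [apply: XA; exists y|exists B].
exists (\bigcup_(y in X) f y); split.
- by apply: bigcup_finite => // y /fP[].
- by move=> z [y /fP[_ + _]]; exact.
- right; exists X => // _ [y Xy <-]; have [_ _] := fP y Xy.
  by apply: infected_mono; exact: bigcup_sup.
Qed.
End closure.

(** * Inner product, sphere and generic vectors *)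

Section directions.
Context (R : realType) (d : nat).
Local Notation W := 'rV[R]_d.

Lemma innerC (u v : W) : inner u v = inner v u.
Proof. by apply: eq_bigr => i _; rewrite mulrC. Qed.

Lemma innerDl (u v w : W) : inner (u + v) w = inner u w + inner v w.
Proof. by rewrite -big_split; apply: eq_bigr => i _; rewrite mxE mulrDl. Qed.

Lemma innerZl (a : R) (u v : W) : inner (a *: u) v = a * inner u v.
Proof. by rewrite /inner mulr_sumr; apply: eq_bigr => i _; rewrite mxE mulrA. Qed.

Lemma inner0l (u : W) : inner 0 u = 0.
Proof. by rewrite -(scale0r u) innerZl mul0r. Qed.

Lemma inner_gt0 (u : W) : u != 0 -> 0 < inner u u.
Proof.
move=> u0; rewrite lt_neqAle sumr_ge0 ?andbT; last by move=> i _; rewrite -expr2 sqr_ge0.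
apply: contra_neq u0 => /esym/eqP; rewrite psumr_eq0; last first.
  by move=> i _; rewrite -expr2 sqr_ge0.
move=> /allP u0; apply/rowP => i; rewrite mxE; apply/eqP.
by have := u0 i (mem_index_enum i); rewrite mulf_eq0 orbb.
Qed.

Lemma cvg_inner {T : Type} {F : set_system T} {FF : Filter F} (f g : T -> W) (a b : W) :
  f x @[x --> F] --> a -> g x @[x --> F] --> b ->
  inner (f x) (g x) @[x --> F] --> inner a b.
Proof.
move=> fa gb; apply: cvg_big => [|i _]; first exact: add_continuous.
apply: cvgM.
  by apply: (@cvg_comp _ _ _ f (fun v : W => v ord0 i) _ _ _ fa); exact: coord_continuous.
by apply: (@cvg_comp _ _ _ g (fun v : W => v ord0 i) _ _ _ gb); exact: coord_continuous.
Qed.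

Lemma continuous_inner (u : W) : continuous (inner u).
Proof. by move=> v; apply: (@cvg_inner _ (nbhs v) _ (fun=> u) id); [exact: cvg_cst|exact: cvg_id]. Qed.

Lemma open_inner_gt0 (u : W) : open [set v | 0 < inner u v].
Proof.
rewrite (_ : [set v | _] = inner u @^-1` [set x | 0 < x]) //.
by apply: open_comp; [move=> v _; exact: continuous_inner|exact: open_gt].
Qed.

Lemma open_inner_neq0 (u : W) : open [set v | inner u v != 0].
Proof.
rewrite (_ : [set v | _] = inner u @^-1` [set x | x != 0]) //.
by apply: open_comp; [move=> v _; exact: continuous_inner|exact: open_neq].
Qed.

Lemma compact_sphere : compact (@sphere R d).
Proof.
pose B : set W := [set v | forall i, [set` `[-1, 1]%R] (v ord0 i)].
apply: (@subclosed_compact _ _ B).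
- rewrite (_ : @sphere R d = (fun u : W => inner u u) @^-1` [set x | x = 1]) //.
  apply: preimage_closed; last exact: closed_eq.
  by move=> u _; apply: (@cvg_inner _ (nbhs u) _ id id); exact: cvg_id.
- exact: (@rV_compact R d (fun=> [set` `[-1, 1]%R]) (fun=> @segment_compact R (-1) 1)).
- move=> u uS i /=; rewrite in_itv /=.
  have : u ord0 i ^+ 2 <= 1.
    rewrite -[leRHS]uS /inner (bigD1 i) //= -expr2 lerDl sumr_ge0 // => j _.
    by rewrite -expr2 sqr_ge0.
  by nra.
Qed.

Definition normalize (x : W) : W := (Num.sqrt (inner x x))^-1 *: x.

Lemma sphere_normalize x : x != 0 -> sphere (normalize x).
Proof.
move=> /inner_gt0 x0; rewrite /sphere /= /normalize innerZl innerC innerZl mulrA.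
by rewrite -expr2 exprVn sqr_sqrtr ?(ltW x0) // mulVf // gt_eqF.
Qed.

Lemma inner_normalize_gt0 (u x : W) : x != 0 -> (0 < inner u (normalize x)) = (0 < inner u x).
Proof.
move=> /inner_gt0 x0.
by rewrite /normalize innerC innerZl innerC pmulr_rgt0 // invr_gt0 sqrtr_gt0.
Qed.

Lemma inner_normalize_ge0 (u x : W) : x != 0 -> (0 <= inner u (normalize x)) = (0 <= inner u x).
Proof.
move=> /inner_gt0 x0.
by rewrite /normalize innerC innerZl innerC pmulr_rge0 // invr_gt0 sqrtr_gt0.
Qed.

Lemma normalize_id u : sphere u -> normalize u = u.
Proof. by rewrite /sphere /= /normalize => ->; rewrite sqrtr1 invr1 scale1r. Qed.

Lemma sphere_neq0 (u : W) : sphere u -> u != 0.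
Proof.
rewrite /sphere /= => u1; apply: contra_eq_neq u1 => ->.
by rewrite inner0l eq_sym oner_eq0.
Qed.

Lemma continuous_normalize u : u != 0 -> {for u, continuous normalize}.
Proof.
move=> /inner_gt0 u0.
have uu : inner x x @[x --> u] --> inner u u.
  by apply: (@cvg_inner _ (nbhs u) _ id id); exact: cvg_id.
have su : Num.sqrt (inner x x) @[x --> u] --> Num.sqrt (inner u u).
  by apply: (@cvg_comp _ _ _ (fun x => inner x x) Num.sqrt _ _ _ uu); exact: sqrt_continuous.
have iu : (Num.sqrt (inner x x))^-1 @[x --> u] --> (Num.sqrt (inner u u))^-1.
  by apply: cvgV su; rewrite gt_eqF // sqrtr_gt0.
exact: (cvgZ iu cvg_id).
Qed.

(** A point of the hyperplane orthogonal to [y] leaves it by a small move along [y] itself. Openness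
    lets the hyperplanes be avoided one after the other. *)
Lemma open_avoids_hyperplanes (O : set W) (ys : seq W) : open O -> O !=set0 ->
  (forall y, y \in ys -> y != 0) ->
  exists2 u, O u & forall y, y \in ys -> inner y u != 0.
Proof.
elim: ys O => [|y ys IH] O Oo [u Ou] ys0; first by exists u.
have [||y' y'ys|w [Ow yw] wys] := IH (O `&` [set v | inner y v != 0]).
- by apply: openI => //; exact: open_inner_neq0.
- have [yu|yu] := eqVneq (inner y u) 0; last by exists u.
  have : \forall t \near (0 : R)^', O (u + t *: y).
    apply: nbhs_dnbhs.
    have : (u + t *: y) @[t --> (0 : R)] --> u + 0 *: y.
      by apply: cvgD; [exact: cvg_cst|apply: cvgZr_tmp; exact: cvg_id].
    by apply; rewrite scale0r addr0; exact: open_nbhs_nbhs.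
  move=> Ot.
  have [t [Out t0]] : exists t : R, O (u + t *: y) /\ t != 0.
    have := filter_ex (filterI Ot (@nbhs_dnbhs_neq _ (0 : R))).
    by move=> [t [h1 h2]]; exists t.
  exists (u + t *: y); split=> //=.
  rewrite innerC innerDl (innerC u) yu add0r innerZl mulf_neq0 //.
  by rewrite gt_eqF // inner_gt0 // ys0 // mem_head.
- by apply: ys0; rewrite inE y'ys orbT.
- by exists w => // y'; rewrite inE => /orP[/eqP ->|/wys].
Qed.
End directions.

(** * Strict directions from stable ones *)

Section strict_directions.
Context (R : realType) (d : nat) (U : set (set 'rV[int]_d)).
Local Notation Z := 'rV[int]_d.
Local Notation W := 'rV[R]_d.
Local Notation real_vec x := (map_mx intr x : W).

Definition strict_direction (u : W) : Prop :=
  forall X, U X -> exists2 y : Z, X y & 0 < inner (real_vec y) u.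

(** If [X] lay in the open half-space, the origin, which does not, would be infected in one step. *)
Lemma stable_direction_ge0 (u : W) X : stable_directions U u -> U X ->
  exists2 y : Z, X y & 0 <= inner (real_vec y) u.
Proof.
move=> [_ stable] UX; apply: contrapT => nX.
have : Uclosure U (half_space u) 0.
  exists 1%N => //=; right; exists X => // _ [y Xy <-]; rewrite add0r /half_space /=.
  by rewrite ltNge; apply/negP => y0; apply: nX; exists y.
rewrite stable /half_space /= (_ : map_mx _ _ = 0) ?map_mx0 //.
by rewrite inner0l ltxx.
Qed.

Lemma real_vec_neq0 (y : Z) : y != 0 -> real_vec y != 0.
Proof.
apply: contra_neq => /rowP y0; apply/rowP => i; have /eqP := y0 i.
by rewrite !mxE intr_eq0 => /eqP.
Qed.

Context (UU : update_family U) (Usub : subcritical R U).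

(** The relative interior given by subcriticality is extended radially to a neighbourhood in the
    whole space. A vector there off the hyperplanes of all points of the rules turns the weak
    inequality of stability into a strict one. *)
Lemma exists_strict_direction (v : W) : sphere v ->
  exists2 u : W, strict_direction u & 0 < inner u v.
Proof.
move=> /Usub[u uint]; have [[uS uv] _] : (hemisphere v `&` stable_directions U) u.
  exact: (@interior_subset (subspace (@sphere R d)) _ _ uint).
have near_u : \forall x \near u, sphere x -> (hemisphere v `&` stable_directions U) x.
  have : nbhs_subspace (u : subspace (@sphere R d)) (hemisphere v `&` stable_directions U) := uint.
  by rewrite -(nbhs_subspace_in uS).
pose O : set W := [set x | x != 0 /\ (sphere (normalize x) ->
  (hemisphere v `&` stable_directions U) (normalize x))].
have Ou : nbhs u O.
  have near_neq0 : \forall x \near u, 0 < inner u x.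
    by apply: open_nbhs_nbhs; split; [exact: open_inner_gt0|rewrite uS ltr01].
  have near_normalize : \forall x \near u, sphere (normalize x) ->
      (hemisphere v `&` stable_directions U) (normalize x).
    have cu : normalize x @[x --> u] --> normalize u.
      exact/continuous_normalize/sphere_neq0.
    by rewrite normalize_id // in cu; exact: (cu _ near_u).
  apply: filterS2 near_neq0 near_normalize => x ux xS; split=> //.
  by apply: contraTneq ux => ->; rewrite innerC inner0l ltxx.
have /finite_seqP[s sE] : finite_set (\bigcup_(X in U) X).
  by apply: bigcup_finite => [|X UX]; case: UU => // _ /(_ X UX)[].
have [|||w /interior_subset[w0 wS] wy] := @open_avoids_hyperplanes R d (interior O) [seq real_vec y | y <- s].
- exact: open_interior.
- by exists u.
- move=> _ /mapP[y ys ->]; apply: real_vec_neq0; apply/eqP => y0.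
  have : [set` s] y by [].
  by rewrite -sE => -[X UX]; rewrite y0; case: UU => _ /(_ X UX)[].
have [[_ wv] wstable] := wS (sphere_normalize w0).
exists w; last by rewrite innerC -inner_normalize_gt0 // innerC.
move=> X UX; have [y Xy yw] := stable_direction_ge0 wstable UX.
exists y => //; rewrite lt_neqAle -inner_normalize_ge0 // yw andbT eq_sym.
by apply: wy; apply: map_f; have : [set` s] y by rewrite -sE; exists X.
Qed.

(** The open half-spaces of strict directions cover the compact sphere; a finite subcover is applied
    to the direction of [- w]. *)
Lemma finite_strict_directions : (1 <= d)%N ->
  exists D : {fset W}, (forall u, u \in D -> strict_direction u) /\
    forall w : Z, exists2 u, u \in D & inner (real_vec w) u <= 0.
Proof.
move=> d1; have := @compact_sphere R d; rewrite compact_cover.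
move=> /(_ W strict_direction (fun u => [set v | 0 < inner u v])).
case=> [u _|v vS|D Dstrict Dcov].
- exact: open_inner_gt0.
- by have [u us uv] := exists_strict_direction vS; exists u.
exists D; split=> [u /Dstrict|w]; first by rewrite inE.
have [w0|w0] := eqVneq w 0.
  (* For [w = 0] any element of [D] will do; [d >= 1] gives a point of the sphere, hence such an
     element. *)
  pose e : W := delta_mx 0 (Ordinal d1).
  have /sphere_normalize/Dcov[u uD _] : e != 0.
    apply/eqP => /rowP/(_ (Ordinal d1)); rewrite !mxE !eqxx => /eqP.
    by rewrite oner_eq0.
  exists u => //; rewrite w0 (_ : map_mx _ _ = 0) ?map_mx0 //.
  by rewrite inner0l.
have Nw0 : - real_vec w != 0 by rewrite oppr_eq0 real_vec_neq0.
have [u uD /=] := Dcov _ (sphere_normalize Nw0).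
rewrite inner_normalize_gt0 // innerC -scaleN1r innerZl mulN1r oppr_gt0 => /ltW.
by exists u.
Qed.
End strict_directions.

(** * From percolation to witnesses, and the bound on the critical probability *)

Section percolation.
Context (R : realType) (d : nat) (U : set (set 'rV[int]_d)).
Local Notation Z := 'rV[int]_d.
Local Notation W := 'rV[R]_d.
Local Notation real_vec x := (map_mx intr x : W).

Lemma ler_norm_inner (u : W) (x : Z) :
  `|inner (real_vec x) u| <= (\sum_i `|u ord0 i|) * (sup_norm x)%:R.
Proof.
rewrite mulr_suml; apply: le_trans (ler_norm_sum _ _ _) _.
apply: ler_sum => i _; rewrite normrM mulrC mxE ler_wpM2l // -intr_norm -abszE -pmulrn.
by rewrite ler_nat leq_sup_norm.
Qed.

Context (UU : update_family U) (D : {fset W}).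
Context (Dstrict : forall u, u \in D -> strict_direction U u).
Context (Dneg : forall w : Z, exists2 u, u \in D & inner (real_vec w) u <= 0).

Lemma direction_bound : exists C : nat,
  forall u, u \in D -> forall x : Z, `|inner (real_vec x) u| <= C%:R * (sup_norm x)%:R.
Proof.
have [||u _|C hC] := @finite_uniform W [set` D] (fun u n => \sum_i `|u ord0 i| <= n%:R).
- exact: finite_fset.
- by move=> u m n mn /le_trans; apply; rewrite ler_nat.
- by exists (Num.bound (\sum_i `|u ord0 i|)); rewrite ltW // archi_boundP // sumr_ge0.
- exists C => u uD x; apply: le_trans (ler_norm_inner u x) _.
  by rewrite ler_wpM2r //; exact: hC.
Qed.

Lemma escape_bound : exists q : nat, forall u, u \in D -> forall X, U X ->
  exists2 y : Z, X y & (sup_norm y <= q)%N /\ (sup_norm y)%:R <= q%:R * inner (real_vec y) u.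
Proof.
(* Positivity of the inner product is recorded to make [Q] monotone in [n]. *)
pose Q (u : W) (X : set Z) (n : nat) := exists2 y : Z, X y &
  [/\ 0 < inner (real_vec y) u, (sup_norm y <= n)%N &
      (sup_norm y)%:R <= n%:R * inner (real_vec y) u].
have Qmono u X m n : (m <= n)%N -> Q u X m -> Q u X n.
  move=> mn [y Xy [y0 ym yu]]; exists y => //; split=> //; first exact: leq_trans mn.
  by apply: (le_trans yu); rewrite ler_wpM2r ?ler_nat // ltW.
have Qex u X : u \in D -> U X -> exists n, Q u X n.
  move=> uD UX; have [y Xy y0] := Dstrict uD UX.
  set b := (sup_norm y)%:R / inner (real_vec y) u.
  exists (maxn (sup_norm y) (Num.bound b)), y => //; split=> //; first exact: leq_maxl.
  rewrite -ler_pdivrMr // -/b; apply: (@le_trans _ _ (Num.bound b)%:R).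
    by rewrite ltW // archi_boundP // divr_ge0 // ltW.
  by rewrite ler_nat leq_maxr.
have [|u m n mn h X UX|u uD|q hq] :=
    @finite_uniform W [set` D] (fun u n => forall X, U X -> Q u X n).
- exact: finite_fset.
- exact: Qmono mn (h X UX).
- by apply: finite_uniform => [|X m n|X]; [case: UU|exact: Qmono|exact: Qex].
- by exists q => u uD X UX; have [y Xy [_ yq yu]] := hq u uD X UX; exists y.
Qed.

Lemma percolation_witness : exists2 q : nat, (16 <= q)%N & forall A : set Z,
  Uclosure U A 0 -> exists n, exists2 T, T \in scale_witnesses d q n & forall t, t \in T -> A t.
Proof.
have [C hC] := direction_bound; have [q0 hq0] := escape_bound.
pose q := maxn q0 (maxn C.+1 16).
have q16 : (16 <= q)%N by rewrite /q; lia.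
have Cq : (C < q)%N by rewrite /q; lia.
exists q => // A /(Uclosure_compact UU)[B [Bfin BA B0]].
pose I := {u : W | u \in D}.
pose L (i : I) (x : Z) := inner (real_vec x) (val i).
have LD i : {morph L i : x y / x + y}.
  by move=> x y; rewrite /L -innerDl; congr inner; rewrite map_mxD.
have LC i x : `|L i x| <= C%:R * (sup_norm x)%:R by apply: hC; exact: valP.
have Lneg w : exists i, L i w <= 0.
  by have [u uD uw] := Dneg w; exists (exist _ u uD).
have [m Bm] : exists m, forall x y : Z, B x -> B y -> (sup_norm (x - y) <= m)%N.
  have [|x _|m hm] := @finite_uniform Z B (fun x n => (sup_norm x <= n)%N) Bfin.
  - by move=> x m n mn xm; exact: leq_trans mn.
  - by exists (sup_norm x).
  - exists (m + m)%N => x y Bx By; apply: leq_trans (sup_normD _ _) _.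
    by rewrite sup_normN leq_add // hm.
have Bsmall := crowded_bounded (leq_trans (isT : 2 <= 16)%N q16) Bm.
have [G [Gsh BG Gcov]] :=
  shielded_cover (@sup_normD d) (@sup_normN d) (@sup_norm0 d) LD LC Lneg q16 Cq Bsmall.
have [|n [y By yM]] := Gcov 0.
  apply: (Uclosure_sub BG) B0 => x X UX XG; apply: contrapT => nGx.
  (* The direction shielding [x] would exclude the point [y] of [X] in its cone, although all of
     [x + X] lies in [G]. *)
  have [i hi] := Gsh x nGx; have [y Xy [yq0 yL]] := hq0 _ (valP i) _ UX.
  have q0q : (q0 <= q)%N by exact: leq_maxl.
  apply: (hi y); last exact: XG.
    exact: leq_trans q0q.
  exact: (cone_le LC q0q).
have {}By := crowded_mono BA By; have [T Ty TA] := crowded_witness By.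
exists n, T => //; apply/flattenP; exists (witnesses q n y) => //.
apply/mapP; exists y => //; apply: mem_ball_seq.
by rewrite sup_norm_distC subr0 in yM.
Qed.
End percolation.

Theorem theorem1p4 (R : realType) (d : nat) (U : set (set 'rV[int]_d)) :
  (1 <= d)%N -> update_family U -> subcritical R U ->
  0 < critical_probability R U.
Proof.
move=> d1 UU Usub.
have [D [Dstrict Dneg]] := finite_strict_directions UU Usub d1.
have [q q16 qW] := percolation_witness UU Dstrict Dneg.
(* There are at most [c ^ (2 ^ n)] witness sets at scale [n], so [1 / (8 c)] is a lower bound for
   the critical probability. *)
pose c := ((q ^ (8 * d)) ^ 6)%N.
have c0 : 0 < (8 * c)%:R :> R by rewrite ltr0n muln_gt0 !expn_gt0; lia.
apply: (@lt_le_trans _ _ (8 * c)%:R^-1); first by rewrite invr_gt0.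
apply: lb_le_inf.
  exists 1; split; first by rewrite ler01 lexx.
  by rewrite percolation_law1 // lee_fin; lra.
move=> p [p01]; rewrite !leNgt => /negP Pp; apply/negP => pc; apply: Pp.
have /andP[p0 p1] := p01.
apply: (law_scales_lt (random_set_lawP d p01) (c := c) (s := scale_witnesses d q)) => //.
- by rewrite mulrC -ler_pdivlMr // mul1r ltW.
- by move=> n; rewrite /c -expnM; exact: size_scale_witnesses.
- by move=> n T /flattenP[_ /mapP[y _ ->]] /(witness_card q16)[].
- exact: measurable_percolation.
- move=> A AU; have [|n [T Tn TA]] := qW A; first by rewrite AU.
  by exists n => //; exists T.
Qed.
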